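(* Let $g=a_1 1_{C}+a_2 1_{X\setminus C}$, where $a_1\neq a_2$ are reals and $C\subseteq X$ is measurable. Assume the map $\theta$ is invertible, and put $\psi_t(y) := \int_X g\circ\varphi_t \, dP_{\theta^{-1}(y)}$ for $t\in T$, $y\in(y_{\min},y_{\max})$, where $T=-T$. If each $\varphi_t$ is invertible with $\varphi_t^{-1}=\varphi_{-t}$ and preserves $\mu$ (i.e. $\mu\circ\varphi_t^{-1}=\mu$), then $\psi_t(y)=\psi_{-t}(y)$ for all $t\in T$ and all $y\in(y_{\min},y_{\max})$.
   Context: Setting. $(X,d)$ is a complete separable metric space with its Borel $\sigma$-algebra and $\mu$ is a Borel probability measure on $X$. $g: X\to\mathbb{R}$ is measurable, bounded, and continuous $\mu$-almost everywhere (i.e. its set of discontinuity points is $\mu$-null). $y_{\min}=\inf g(X)$, $y_{\max}=\sup g(X)$, $Y=[y_{\min},y_{\max}]$. $T\subseteq\mathbb{R}$ is a set of times with $0\in T$; for each $t\in T$, $\varphi_t:X\to X$ is measurable and continuous $\mu$-a.e., with $\varphi_0=\mathrm{id}$. Canonical measures. For $\lambda\in\mathbb{R}$, $Z(\lambda)=\int_X e^{\lambda g}\,d\mu$ and $P_\lambda$ is the probability measure with $dP_\lambda = \frac{e^{\lambda g}}{Z(\lambda)}\,d\mu$. The map $\theta:[-\infty,+\infty]\to Y$ is given by $\theta(\lambda)=\int_X g\,dP_\lambda$ for $\lambda\in\mathbb{R}$, $\theta(-\infty)=y_{\min}$, $\theta(+\infty)=y_{\max}$. *)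

(* Defs.v *)
From HB Require Import structures.
From mathcomp Require Import all_boot all_order all_algebra.
From mathcomp Require Import all_classical all_reals all_analysis.
From mathcomp Require Import measurable_realfun.

Set Implicit Arguments.
Unset Strict Implicit.
Unset Printing Implicit Defensive.

Import Order.TTheory GRing.Theory Num.Theory.
Import numFieldNormedType.Exports.

Local Open Scope classical_set_scope.
Local Open Scope ring_scope.

#[short(type="completeMetricType")]
HB.structure Definition CompleteMetric (R : numDomainType) :=
  {X of Complete X & Metric R X}.

Definition separable (X : topologicalType) : Prop :=
  exists2 D : set X, countable D & dense D.

Notation borel X := (g_sigma_algebraType (@open X)).

Section canonical_measure.
Context d (X : measurableType d) (R : realType).
Variables (mu : {measure set X -> \bar R}) (g : {mfun X >-> R}).

Definition partition_fun (lambda : R) : R := \int[mu]_x expR (lambda * g x).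

Definition canonical_measure (lambda : R) (A : set X) : \bar R :=
  (\int[mu]_(x in A) (expR (lambda * g x) / partition_fun lambda)%:E)%E.

Section measure_instance.
Variable lambda : R.

Lemma partition_fun_ge0 : 0 <= partition_fun lambda.
Proof. by apply: Rintegral_ge0 => x _; exact: expR_ge0. Qed.

Let density_ge0 x : (0 <= (expR (lambda * g x) / partition_fun lambda)%:E)%E.
Proof. by rewrite lee_fin divr_ge0 ?expR_ge0 ?partition_fun_ge0. Qed.

Lemma measurable_expRM : measurable_fun [set: X] (fun x => expR (lambda * g x)).
Proof.
by apply: measurableT_comp => //; apply: measurable_funM => //; exact: measurable_funPT.
Qed.

Let canonical0 : canonical_measure lambda set0 = 0%E.
Proof. by rewrite /canonical_measure integral_set0. Qed.

Let canonical_ge0 A : (0 <= canonical_measure lambda A)%E.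
Proof. by apply: integral_ge0 => x _; exact: density_ge0. Qed.

Let canonical_sigma_additive : semi_sigma_additive (canonical_measure lambda).
Proof.
apply: semi_sigma_additive_nng_induced => //.
apply/measurable_EFinP; apply: measurable_funM => //.
exact: measurable_expRM.
Qed.

HB.instance Definition _ := isMeasure.Build _ _ _ (canonical_measure lambda)
  canonical0 canonical_ge0 canonical_sigma_additive.

End measure_instance.

Definition ymin : R := inf (range g).
Definition ymax : R := sup (range g).

Definition theta (l : \bar R) : R :=
  match l with
  | lambda%:E => \int[canonical_measure lambda]_x g x
  | +oo%E => ymax
  | -oo%E => ymin
  end.

(* Meaningful when [theta] is a bijection from \bar R onto [ymin, ymax]. *)
Definition theta_inv : R -> \bar R := pinv setT theta.

(* For ymin < y < ymax a bijective [theta] has a finite preimage of y, since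
   the two infinite points are sent to ymin and ymax; [fine] then only removes
   the injection of R into \bar R. *)
Definition psi (phi : R -> X -> X) (t y : R) : R :=
  \int[canonical_measure (fine (theta_inv y))]_x g (phi t x).

End canonical_measure.

Section canonical_probability.
Context d (X : measurableType d) (R : realType).
Variables (mu : probability X R) (g : {mfun X >-> R}).

Lemma canonical_measure_setT (lambda : R) : bounded_fun g ->
  canonical_measure mu g lambda [set: X] = 1%E.
Proof.
move=> gbd; have [M [Mr gM]] : [bounded g x | x in [set: X]] := gbd.
have gb x : `|g x| <= `|M| + 1.
  by apply: (gM (`|M| + 1)) => //; rewrite (le_lt_trans (ler_norm _)) ?ltrDl.
have mE := measurable_expRM g lambda.
have iE : mu.-integrable [set: X] (EFin \o (fun x => expR (lambda * g x))).
  apply: measurable_bounded_integrable => //.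
    by rewrite -ge0_fin_numE ?fin_num_measure.
  exists (expR (`|lambda| * (`|M| + 1))); split; first by rewrite num_real.
  move=> K KM x _ /=; rewrite ger0_norm ?expR_ge0//.
  rewrite (le_trans _ (ltW KM))// ler_expR (le_trans (ler_norm _))// normrM.
  by rewrite ler_wpM2l.
have Z0 : 0 < partition_fun mu g lambda.
  apply: (@lt_le_trans _ _ (expR (- (`|lambda| * (`|M| + 1))))).
    exact: expR_gt0.
  rewrite -lee_fin /partition_fun fineK; last exact: integrable_fin_num.
  rewrite -[leLHS]mule1 -(@probability_setT _ _ _ mu) -integral_cst//.
  apply: ge0_le_integral => //.
  - by move=> x _; rewrite lee_fin expR_ge0.
  - exact/measurable_EFinP.
  - move=> x _; rewrite lee_fin ler_expR lerNl.
    by rewrite (le_trans (ler_norm _))// normrN normrM ler_wpM2l.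
rewrite /canonical_measure.
under eq_integral do rewrite EFinM muleC.
rewrite integralZl// -[X in (_ * X)%E]fineK; last exact: integrable_fin_num.
by rewrite -EFinM mulVf// gt_eqF.
Qed.

End canonical_probability.

(* Main.v *)
Require Import Defs.
From mathcomp Require Import all_boot all_order all_algebra.
From mathcomp Require Import all_classical all_reals all_analysis.
From mathcomp Require Import measurable_realfun.

Set Implicit Arguments.
Unset Strict Implicit.
Unset Printing Implicit Defensive.

Import Order.TTheory GRing.Theory Num.Theory.
Import numFieldNormedType.Exports.

Local Open Scope classical_set_scope.
Local Open Scope ring_scope.

(* Since g takes two values, so does the density of P_lambda, hence P_lambda(A)
   is a fixed linear combination of mu(A n C) and mu(A \ C).  For a
   mu-preserving bijection f with inverse f', invariance gives
   mu(f^-1(C) n C) = mu(C n f'^-1(C)), and then, mu being finite with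
   mu(f^-1(C)) = mu(C) = mu(f'^-1(C)), also mu(f^-1(C) \ C) = mu(f'^-1(C) \ C).
   So P_lambda(f^-1(C)) = P_lambda(f'^-1(C)), and the integrals of g o f and
   g o f' depend on these probabilities only. *)

Section two_valued.
Context d (X : measurableType d) (R : realType).
Implicit Types (mu : {measure set X -> \bar R}) (A C : set X).

(** Stated for any finite measure, so that it applies to [canonical_measure], whose total mass is
    known only through an equation. *)
Lemma Rintegral_two_valued mu A (a1 a2 : R) :
  (mu setT < +oo)%E -> measurable A ->
  \int[mu]_x (a1 * \1_A x + a2 * \1_(~` A) x) =
  a1 * fine (mu A) + a2 * fine (mu (~` A)).
Proof.
move=> muoo mA.
(* Linearity of the real-valued integral requires integrable indicators; finiteness of the total
   mass provides this. *)
have ind B : measurable B ->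
    mu.-integrable setT (EFin \o (\1_B : X -> R)) /\
    \int[mu]_x (\1_B x : R) = fine (mu B).
  move=> mB; have iB : (\int[mu]_x (\1_B x : R)%:E = mu B)%E.
    by rewrite integral_indic ?setIT.
  split; last by rewrite /Rintegral iB.
  apply/integrableP; split; first exact/measurable_EFinP.
  under eq_integral do rewrite /= ger0_norm//.
  by rewrite iB (le_lt_trans _ muoo)// le_measure ?inE.
have [iA IA] := ind _ mA; have [iA' IA'] := ind _ (measurableC mA).
have mulE (a : R) B : EFin \o (fun x => a * \1_B x) =
    (fun x : X => a%:E * (\1_B x)%:E)%E by apply/funext => x /=; rewrite EFinM.
rewrite RintegralD//; last 2 first.
- by rewrite mulE; exact: integrableZl.
- by rewrite mulE; exact: integrableZl.
by rewrite !RintegralZl// IA IA'.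
Qed.

Lemma canonical_measure_two_valued mu (g : {mfun X >-> R}) C (a1 a2 lambda : R)
    A :
  measurable C -> (forall x, g x = a1 * \1_C x + a2 * \1_(~` C) x) ->
  measurable A ->
  (canonical_measure mu g lambda A =
   (expR (lambda * a1) / partition_fun mu g lambda)%:E * mu (A `&` C) +
   (expR (lambda * a2) / partition_fun mu g lambda)%:E * mu (A `\` C))%E.
Proof.
move=> mC gE mA; rewrite /canonical_measure.
have mAC := measurableI _ _ mA mC; have mADC := measurableD mA mC.
rewrite -[in LHS](setUIDK A C) integral_setU//; last 2 first.
- apply: measurable_funTS; apply/measurable_EFinP.
  by apply: measurable_funM => //; exact: measurable_expRM.
- by rewrite disj_set2E; apply/eqP; rewrite setDE setIACA setICr setI0.
(* Each product on the right becomes the integral of a constant, to be compared pointwise with the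
   density on its piece of [A]. *)
rewrite -!integral_cst//; congr (_ + _)%E;
  apply: eq_integral => x; rewrite inE => -[_ Cx].
- by rewrite gE !indicE mem_set// memNset ?mulr1 ?mulr0 ?addr0//; apply.
- by rewrite gE !indicE memNset// mem_set ?mulr1 ?mulr0 ?add0r.
Qed.

End two_valued.

Section measure_preserving_inverse.
Context d (X : measurableType d) (R : realType).
Variables (mu : probability X R) (f f' : X -> X).
Hypotheses (mf : measurable_fun setT f) (mf' : measurable_fun setT f').
Hypothesis fK : cancel f f'.
Hypothesis mu_f : forall A, measurable A -> pushforward mu f A = mu A.
Hypothesis mu_f' : forall A, measurable A -> pushforward mu f' A = mu A.

Let mpre (h : X -> X) C : measurable_fun setT h -> measurable C ->
  measurable (h @^-1` C).
Proof. by move=> mh mC; rewrite -[_ @^-1` _]setTI; exact: mh. Qed.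

Lemma measure_preimageI_inverse C : measurable C ->
  mu (f @^-1` C `&` C) = mu (f' @^-1` C `&` C).
Proof.
move=> mC; rewrite -[RHS]mu_f; last by apply: measurableI => //; exact: mpre.
(* Pulling back along [f] swaps the two conditions: f x lies in f'^-1(C) iff x lies in C. *)
by congr (mu _); apply/seteqP; split=> x /=; rewrite fK => -[].
Qed.

Lemma measure_preimageD_inverse C : measurable C ->
  mu (f @^-1` C `\` C) = mu (f' @^-1` C `\` C).
Proof.
move=> mC; have [mfC mf'C] := (mpre mf mC, mpre mf' mC).
have fin B : measurable B -> mu B \is a fin_num by exact: fin_num_measure.
have muD h : measurable (h @^-1` C) -> pushforward mu h C = mu C ->
    mu (h @^-1` C `\` C) = (mu C - mu (h @^-1` C `&` C))%E.
  (* The preimage is split along [C]; cancelling in the extended reals is legitimate because the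
     intersection has finite measure. *)
  move=> mhC <-; rewrite /pushforward (measureDI mu mhC mC) addeK//.
  exact/fin/measurableI.
by rewrite !muD ?mu_f ?mu_f'// measure_preimageI_inverse.
Qed.

Lemma Rintegral_canonical_measure_inverse (g : {mfun X >-> R}) C
    (a1 a2 lambda : R) :
  bounded_fun g -> measurable C ->
  (forall x, g x = a1 * \1_C x + a2 * \1_(~` C) x) ->
  \int[canonical_measure mu g lambda]_x g (f x) =
  \int[canonical_measure mu g lambda]_x g (f' x).
Proof.
move=> gbd mC gE.
set P : {measure set X -> \bar R} := canonical_measure mu g lambda.
(* Boundedness of [g] enters here: it makes the normalising constant finite and positive. *)
have PT : P setT = 1%E by exact: canonical_measure_setT.
have PC B : measurable B -> P (~` B) = (1 - P B)%E.
  move=> mB; rewrite -PT -setTD.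
  have finB : (P B \is a fin_num).
    by rewrite ge0_fin_numE// (@le_lt_trans _ _ (P setT))
      ?le_measure ?inE ?PT ?ltry.
  have -> : (P setT = P (setT `\` B) + P B)%E.
    by have := measureDI P measurableT mB; rewrite setTI.
  by rewrite addeK.
(* With the complement eliminated, the integral depends on [h] only through the number
   P(h^-1(C)). *)
have intE h : measurable_fun setT h -> \int[P]_x g (h x) =
    a1 * fine (P (h @^-1` C)) + a2 * fine (1 - P (h @^-1` C)).
  move=> mh; have mhC := mpre mh mC.
  rewrite -PC// -Rintegral_two_valued ?PT ?ltry//.
  by apply: eq_Rintegral => x _; rewrite gE.
have PE B : measurable B -> P B = _ :=
  @canonical_measure_two_valued _ _ _ mu g C a1 a2 lambda B mC gE.
have PfC : P (f @^-1` C) = P (f' @^-1` C).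
  rewrite !PE; [|exact: mpre..].
  congr (_ * _ + _ * _)%E.
  - exact: measure_preimageI_inverse.
  - exact: measure_preimageD_inverse.
by rewrite !intE// PfC.
Qed.

End measure_preserving_inverse.

Theorem mainTheorem7 (R : realType) (X : completeMetricType R)
    (hX : separable X)
    (mu : probability (borel X) R)
    (g : {mfun borel X >-> R})
    (g_bounded : bounded_fun g)
    (g_continuous : {ae mu, forall x : X, {for x, continuous (g : X -> R)}})
    (T : set R) (T0 : T 0)
    (phi : R -> X -> X)
    (phi_measurable : forall t, T t ->
      measurable_fun [set: borel X] (phi t : borel X -> borel X))
    (phi_continuous : forall t, T t ->
      {ae mu, forall x : X, {for x, continuous (phi t)}})
    (phi0 : phi 0 = id)
    (a1 a2 : R) (a12 : a1 != a2)
    (C : set X) (C_measurable : measurable (C : set (borel X)))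
    (g_def : forall x : X, g x = a1 * \1_C x + a2 * \1_(~` C) x)
    (theta_invertible :
      set_bij [set: \bar R] [set` `[ymin g, ymax g]] (theta mu g))
    (T_sym : T = [set - t | t in T])
    (phi_invertible : forall t, T t ->
      cancel (phi t) (phi (- t)) /\ cancel (phi (- t)) (phi t))
    (phi_preserves : forall t, T t ->
      forall A : set (borel X), measurable A ->
        pushforward mu (phi t : borel X -> borel X) A = mu A)
    (t : R) (ht : T t) (y : R) (hy : ymin g < y < ymax g) :
  psi mu g phi t y = psi mu g phi (- t) y.
Proof.
(* Symmetry of [T] makes measurability and invariance available for [phi (- t)] too. *)
have hNt : T (- t) by rewrite T_sym; exists t.
have [fK _] := phi_invertible t ht.
(* Both sides integrate against the same canonical measure; unification with [psi] sets its
   parameter to [fine (theta_inv y)]. *)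
by apply: (Rintegral_canonical_measure_inverse (phi_measurable _ ht)
  (phi_measurable _ hNt) fK (phi_preserves _ ht) (phi_preserves _ hNt)
  _ g_bounded C_measurable g_def).
Qed.
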